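(* Let $q$ be a prime power, $e\ge1$, $Q=q^e$, and $n\ge0$ an integer. The polynomial $g_{n,q}(X,Y)$ is a local permutation polynomial over $\mathbb{F}_Q$ if and only if $g_{n,q}(X)$ is a permutation polynomial over $\mathbb{F}_Q$.
   Context: For a prime power $q$ (a power of the prime $p$) and an integer $n\ge 0$, $g_{n,q}(X)\in\mathbb{F}_p[X]$ denotes the unique polynomial satisfying $\sum_{a\in\mathbb{F}_q}(X+a)^n=g_{n,q}(X^q-X)$, and the bivariate polynomial is $g_{n,q}(X,Y)=g_{n,q}(X+Y)$, i.e. the univariate polynomial evaluated at $X+Y$. A univariate polynomial over $\mathbb{F}_Q$ is a permutation polynomial over $\mathbb{F}_Q$ if it induces a bijection of $\mathbb{F}_Q$. A polynomial $f\in\mathbb{F}_Q[X,Y]$ is a local permutation polynomial if for every $a\in\mathbb{F}_Q$ both $f(X,a)$ and $f(a,Y)$ are permutation polynomials over $\mathbb{F}_Q$. *)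

(* Defs.v *)
From HB Require Import structures.
From mathcomp Require Import all_boot all_algebra all_field.

Set Implicit Arguments.
Unset Strict Implicit.
Unset Printing Implicit Defensive.

Import GRing.Theory.
Local Open Scope ring_scope.

(* The inclusion of the prime field, meaningful when p \in [pchar F]. *)
Definition Fp_incl (p : nat) (F : nzRingType) (x : 'F_p) : F := (val x)%:R.
Arguments Fp_incl : clear implicits.

(* Fq ranges over the models of the field with q elements, q a power of p. *)
Section GPolynomial.

Variables (p : nat) (Fq : finFieldType).
Local Notation q := #|Fq|.

Definition is_gpoly (n : nat) (g : {poly 'F_p}) : bool :=
  \sum_(a : Fq) ('X + a%:P) ^+ n == map_poly (Fp_incl p Fq) g \Po ('X^q - 'X).

Hypothesis chFq : p \in [pchar Fq].

Let incl_alg (g : {poly 'F_p}) :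
  map_poly (Fp_incl p Fq) g = map_poly (in_alg (pPrimeCharType chFq)) g.
Proof. by apply: eq_map_poly => x; rewrite in_algE /= [RHS]mulr1. Qed.

Let q_gt1 : (1 < q)%N. Proof. exact: finNzRing_gt1. Qed.

Let pr_p : prime p. Proof. exact: pcharf_prime chFq. Qed.

Let qE : q = (p ^ logn p q)%N. Proof. exact: card_pprimeChar chFq. Qed.

Let q_eq0 : q%:R = 0 :> Fq.
Proof.
apply/eqP; rewrite -(dvdn_pcharf chFq) qE.
by move: q_gt1; rewrite {1}qE; case: (logn _ _) => // k _; rewrite expnS dvdn_mulr.
Qed.

Let size_XqX : size ('X^q - 'X : {poly Fq}) = q.+1.
Proof. by rewrite size_polyDl size_polyXn // size_polyN size_polyX ltnS. Qed.

Let XaXq (a : Fq) : ('X + a%:P) ^+ q = 'X^q + a%:P :> {poly Fq}.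
Proof.
have chP : p \in [pchar {poly Fq}] by rewrite pchar_poly.
rewrite exprDn_pchar; last first.
  by rewrite qE pnatX (pi_pnat _ chP) // pnat_id.
by rewrite -polyC_exp expf_card.
Qed.

Let power_sum (j : nat) : (j < q.-1)%N -> \sum_(a : Fq) a ^+ j = 0.
Proof.
case: j => [|j] ltjq.
  rewrite (eq_bigr (fun=> 1)) => [|a _]; last by rewrite expr0.
  by rewrite sumr_const.
have [u u_nz uj] : exists2 u : Fq, u != 0 & u ^+ j.+1 != 1.
  apply/exists_inP; apply: contraLR ltjq; rewrite negb_exists_in => /forall_inP allu.
  rewrite -leqNgt.
  have szP : size ('X^(j.+1) - 1%:P : {poly Fq}) = j.+2.
    by rewrite size_XnsubC.
  have P_nz : ('X^(j.+1) - 1%:P : {poly Fq}) != 0 by rewrite -size_poly_eq0 szP.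
  have := @max_poly_roots _ _ (enum (predC1 (0 : Fq))) P_nz.
  rewrite szP ltnS -cardE cardC1 enum_uniq.
  apply=> //; apply/allP => u; rewrite mem_enum inE => u_nz.
  by rewrite rootE !hornerE subr_eq0 ; move: (allu u u_nz); rewrite negbK.
have : (u ^+ j.+1 - 1) * (\sum_(a : Fq) a ^+ j.+1) = 0.
  rewrite mulrBl mul1r [X in _ - X](reindex_onto (fun a => u * a) (fun a => u^-1 * a)) /=.
    rewrite mulr_sumr (eq_bigl xpredT) => [|a]; last by rewrite mulKf ?eqxx.
    by rewrite -sumrB big1 // => a _; rewrite exprMn subrr.
  by move=> a _; rewrite mulVKf.
by move/eqP; rewrite mulf_eq0 subr_eq0 (negPf uj) => /eqP.
Qed.

Let power_sum_last : \sum_(a : Fq) a ^+ q.-1 = -1.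
Proof.
rewrite (bigD1 0) //= expr0n -subn1 subn_eq0 leqNgt q_gt1 add0r subn1.
rewrite (eq_bigr (fun=> 1)) => [|a a_nz].
  rewrite sumr_const -[X in _ *+ X]/(#|predC1 (0 : Fq)|) cardC1.
  by apply/eqP; rewrite -addr_eq0 -mulrSr prednK ?q_eq0 // ltnW.
apply: (mulfI a_nz); rewrite mulr1 -exprS prednK ?expf_card //.
exact: ltnW.
Qed.

Lemma gpoly_exists (n : nat) : exists g, is_gpoly n g.
Proof.
rewrite /is_gpoly; elim/ltn_ind: n => n IHn.
have [ltnq | leqn] := ltnP n q.
  have sumE : \sum_(a : Fq) ('X + a%:P) ^+ n
      = \sum_(i < n.+1) 'X^(n - i) * (\sum_a a ^+ i)%:P *+ 'C(n, i).
    under eq_bigr => a _ do rewrite exprDn.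
    rewrite exchange_big /=; apply: eq_bigr => i _.
    rewrite raddf_sum /= mulr_sumr -sumrMnl.
    by apply: eq_bigr => a _; rewrite polyC_exp.
  rewrite sumE big_ord_recr /= subnn mul1r binn mulr1n big1 ?add0r; last first.
    move=> i _; rewrite power_sum ?mulr0 ?mul0rn //.
    by rewrite (leq_trans (ltn_ord i)) // -ltnS prednK ?(ltnW q_gt1).
  have [->|neq] := eqVneq n q.-1.
    have inclN1 := rmorphN1 (in_alg (pPrimeCharType chFq)).
    exists (-1)%:P; rewrite power_sum_last incl_alg map_polyC comp_polyC.
    by rewrite [X in _ == X%:P]inclN1.
  exists 0; rewrite power_sum ?incl_alg ?rmorph0 ?comp_poly0 //.
  by rewrite ltn_neqAle neq -ltnS prednK // ltnW.
rewrite -(subnK leqn); set m := (n - q)%N.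
have [|g0 /eqP g0P] := IHn m; first by rewrite /m ltn_subrL ltnW ?(leq_trans _ leqn) // ltnW.
have [|g1 /eqP g1P] := IHn m.+1.
  by rewrite -(subnK leqn) -/m -addn1 ltn_add2l.
exists (g1 + 'X * g0).
rewrite incl_alg rmorphD rmorphM /= map_polyX -!incl_alg comp_polyD comp_polyM.
rewrite comp_polyX -g0P -g1P mulr_sumr -big_split /=; apply/eqP.
apply: eq_bigr => a _; rewrite exprD exprS XaXq -mulrDl mulrC; congr (_ * _).
by rewrite [RHS]addrC addrA subrK.
Qed.

Lemma gpoly_unique (n : nat) (g h : {poly 'F_p}) :
  is_gpoly n g -> is_gpoly n h -> g = h.
Proof.
rewrite /is_gpoly => /eqP-> /eqP/eqP.
rewrite -subr_eq0 -comp_polyB comp_poly_eq0 ?size_XqX ?ltnS ?(ltnW q_gt1) //.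
rewrite subr_eq0 !incl_alg => /eqP gh.
exact: (map_poly_inj (in_alg (pPrimeCharType chFq)) gh).
Qed.

Definition gpoly (n : nat) : {poly 'F_p} := xchoose (gpoly_exists n).

Lemma gpolyP (n : nat) : is_gpoly n (gpoly n).
Proof. exact: xchooseP. Qed.

(* In {poly {poly R}} the outer variable is X and the inner one is Y, as in
   polyXY; poly_XaY is the substitution of X + Y. *)
Definition gpolyXY (n : nat) : {poly {poly 'F_p}} := poly_XaY (gpoly n).

End GPolynomial.

Definition permutation_poly (F : finFieldType) (f : {poly F}) : Prop :=
  bijective (horner f).

(* map_poly (horner_eval a) f is f(X, a), and f.[a%:P] is f(a, Y). *)
Definition local_permutation_poly (F : finFieldType) (f : {poly {poly F}}) :
    Prop :=
  forall a : F, permutation_poly (map_poly (horner_eval a) f)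
             /\ permutation_poly f.[a%:P].

(* Main.v *)
Require Import Defs.
From mathcomp Require Import all_boot all_algebra all_field.

Set Implicit Arguments.
Unset Strict Implicit.
Unset Printing Implicit Defensive.

Import GRing.Theory.
Local Open Scope ring_scope.

(** Fixing either variable of f(X + Y) at a gives the same polynomial f(a + T), which is f composed
    with a translation of the field. Translations are bijections, so each specialisation permutes
    the field exactly when f does: this is [local_permutation_poly_XaY]. [map_poly_XaY] transfers it
    to [gpolyXY], whose coefficients must first be sent from the prime field into [FQ]. *)

Lemma map_poly_XaY (R S : nzRingType) (f : {rmorphism R -> S}) (g : {poly R}) :
  map_poly (map_poly f) (poly_XaY g) = poly_XaY (map_poly f g).
Proof.
rewrite /poly_XaY map_comp_poly rmorphD /= map_polyX map_polyC /= map_polyX.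
congr (_ \Po _); rewrite -!map_poly_comp /=.
by apply: eq_map_poly => x /=; rewrite map_polyC.
Qed.

Lemma permutation_poly_shift (F : finFieldType) (f : {poly F}) (a : F) :
  permutation_poly (f \Po (a%:P + 'X)) <-> permutation_poly f.
Proof.
have addaK : cancel (+%R a) (+%R (- a)) := addKr a.
have addNaK : cancel (+%R (- a)) (+%R a) := addNKr a.
have shiftE : horner (f \Po (a%:P + 'X)) =1 horner f \o +%R a.
  by move=> x; rewrite horner_comp !hornerE.
split=> bij_f; last first.
  by apply: (eq_bij _ (fsym shiftE)); apply: bij_comp bij_f (Bijective addaK addNaK).
apply: (eq_bij (bij_comp bij_f (Bijective addNaK addaK))) => x /=.
by rewrite shiftE /= addNaK.
Qed.

Lemma local_permutation_poly_XaY (F : finFieldType) (f : {poly F}) :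
  local_permutation_poly (poly_XaY f) <-> permutation_poly f.
Proof.
have shiftE (a : F) :
    permutation_poly (map_poly (horner_eval a) (poly_XaY f))
      /\ permutation_poly (poly_XaY f).[a%:P] <-> permutation_poly f.
  (* Symmetry of X + Y under exchange of the variables turns f(X, a) into f(a, Y); both goals then
     concern [f \Po (a%:P + 'X)]. *)
  rewrite -horner_swapXY swapXY_poly_XaY horner_poly_XaY.
  by have := permutation_poly_shift f a; tauto.
(* A single value of a already gives back f; 0 serves as witness that the field is inhabited. *)
by split=> [/(_ 0)/shiftE | pf a]; last apply/shiftE.
Qed.

Theorem proposition5p5 (p q e n : nat) (Fq FQ : finFieldType)
    (chFq : p \in [pchar Fq]) (cardFq : #|Fq| = q)
    (e_gt0 : (0 < e)%N) (cardFQ : #|FQ| = (q ^ e)%N) :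
  local_permutation_poly
    (map_poly (map_poly (Fp_incl p FQ)) (gpolyXY chFq n))
  <-> permutation_poly (map_poly (Fp_incl p FQ) (gpoly chFq n)).
Proof.
have pr_p : prime p := pcharf_prime chFq.
have chFQ : p \in [pchar FQ].
  apply: (@card_finPcharP _ _ (logn p q * e)) => //.
  by rewrite cardFQ expnM -{1}cardFq (card_pprimeChar chFq) cardFq.
(* [Fp_incl] is a bare function; identifying it with the structure map of the F_p-algebra [FQ]
   supplies the ring morphism that [map_poly_XaY] requires. *)
have inclE : Fp_incl p FQ =1 in_alg (pPrimeCharType chFQ).
  by move=> x; rewrite in_algE /= [RHS]mulr1.
rewrite (eq_map_poly inclE) (eq_map_poly (eq_map_poly inclE)).
have -> := map_poly_XaY (in_alg (pPrimeCharType chFQ)) (gpoly chFq n).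
exact: local_permutation_poly_XaY.
Qed.
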